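(* Let $G$ be a connected graph with $v(G)\ge 2$ and without vertices of degree $2$. Then there is a spanning tree of $G$ with at least $\frac{1}{4}(v(G)-2)+2$ leaves.
   Context: All graphs are finite, without loops and multiple edges. $v(G)$ denotes the number of vertices of $G$. A leaf of a tree is a vertex of degree $1$ in that tree. *)

(* Defs.v *)
From mathcomp Require Import all_boot all_order all_algebra.

Set Implicit Arguments.
Unset Strict Implicit.
Unset Printing Implicit Defensive.

(** A finite simple graph is a symmetric irreflexive relation
    [e : rel T] (adjacency) on its finite type [T] of vertices. *)

Section Graphs.
Variable T : finType.
Implicit Types (e t : rel T) (x : T).

Definition simple_graph e : Prop := symmetric e /\ irreflexive e.

Definition degree e x : nat := #|[set y | e x y]|.

(** The empty graph also satisfies this. *)
Definition connected_graph e : Prop := forall x y, connect e x y.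

(** [ucycle e c] allows the degenerate closed walks [[::]] and [[:: x; y]]
    (an edge traversed back and forth); the graph-theoretic cycles are the
    [ucycle]s with at least three vertices. *)
Definition acyclic_graph e : Prop :=
  forall c : seq T, 2 < size c -> ~ ucycle e c.

Definition is_tree t : Prop :=
  [/\ simple_graph t, connected_graph t & acyclic_graph t].

(** A subgraph on the same vertex type automatically spans. *)
Definition spanning_tree e t : Prop := subrel t e /\ is_tree t.

Definition leaves t : {set T} := [set x | degree t x == 1].

End Graphs.

(* Main.v *)
Require Import Defs.
From mathcomp Require Import all_boot all_order all_algebra.
From mathcomp Require Import zify lra.

(** A spanning tree whose non-leaves lie in [I] exists as soon as [I] is a
    connected dominating set, so it suffices to find a connected dominating set
    [I] with [4 * #|I| + 6 <= 3 * #|T|].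

    Such a set is grown greedily.  A connected set [I] stands for a partial tree
    that spans its closed neighbourhood [ball I]; its leaves are the vertices
    of [ball I] outside [I], and a leaf is dead when all its neighbours are
    already in [ball I].  With [N] vertices, [L] leaves and [M] dead leaves,
    [I] can always be enlarged without decreasing the quantity
    [3 L + M - N = 2 * #|ball I| + #|dead I| - 3 * #|I|] ([dense_step]).
    Indeed, let [v] be a leaf with a neighbour [x] outside [ball I].  Promoting
    [v] to an inner vertex costs [3], and each new vertex brings [2], so two new
    vertices are enough.  If no leaf sees two new vertices, then either [x] is
    pendant and becomes a dead leaf, or [x] has another neighbour in [ball I],
    which dies, or [x] has at least two neighbours outside [ball I] and
    promoting both [v] and [x] costs [6] and brings at least three vertices.

    The star of a vertex of degree at least [3] has value at least [5].  At the
    end every leaf is dead, so [4 L] equals [#|T|] plus the final value, which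
    must therefore be at least [6].  If there is a pendant vertex, the star of
    its neighbour has a dead leaf and value [6] from the start.  Otherwise the
    missing unit comes from the last step, or from the star if it spans:
    either that step already has a surplus, or the leaves that it creates are
    dead at once and count as well.
    The invariant [dense] covers both cases. *)

Set Implicit Arguments.
Unset Strict Implicit.
Unset Printing Implicit Defensive.

(** * Trees given by a parent function *)

Section ParentTree.
Variables (T : finType) (r : T) (p : T -> T) (d : T -> nat).
Hypothesis depth_parent : forall x, x != r -> d (p x) < d x.

Definition parent_rel : rel T :=
  [rel x y | ((x != r) && (p x == y)) || ((y != r) && (p y == x))].

Lemma parent_rel_sym : symmetric parent_rel.
Proof. by move=> x y; apply: orbC. Qed.

Lemma parent_relP x y : parent_rel x y -> d y <= d x -> x != r /\ p x = y.
Proof.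
case/orP=> /andP[nr /eqP <-] // le_d.
by have := depth_parent nr; rewrite ltnNge le_d.
Qed.

Lemma parent_rel_irr : irreflexive parent_rel.
Proof.
move=> x; apply/negP=> xx; have [nr px] := parent_relP xx (leqnn _).
by have := depth_parent nr; rewrite px ltnn.
Qed.

Lemma parent_rel_connected : connected_graph parent_rel.
Proof.
have to_root x : connect parent_rel x r.
  have [n] := ubnP (d x); elim: n x => // n IHn x lt_dn.
  case: (eqVneq x r) => [-> | nr]; first exact: connect0.
  apply: (@connect_trans _ _ (p x)).
    by apply: connect1; apply/orP; left; rewrite nr /=.
  by apply: IHn; apply: leq_trans (depth_parent nr) _.
move=> x y; apply: connect_trans (to_root x) _.
by rewrite (sym_connect_sym parent_rel_sym).
Qed.

(** On a cycle, both neighbours of a deepest vertex would be its parent. *)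
Lemma parent_rel_acyclic : acyclic_graph parent_rel.
Proof.
move=> c size_c /andP[cyc_c uniq_c].
have [x0 x0c] : exists x, x \in c.
  by case: c size_c {cyc_c uniq_c} => // x c _; exists x; apply: mem_head.
case: (arg_maxnP d x0c) => x xc max_x.
have [i s rot_c] := rot_to xc.
have : cycle parent_rel (x :: s) by rewrite -rot_c rot_cycle.
have : uniq (x :: s) by rewrite -rot_c rot_uniq.
have mem_s : {subset x :: s <= c} by move=> y; rewrite -rot_c mem_rot.
have : 2 < size (x :: s) by rewrite -rot_c size_rot.
case/lastP: s mem_s {rot_c} => // s z mem_s.
case: s mem_s => // y s mem_s _.
rewrite /= rcons_path last_rcons => uniq_s /and3P[xy _ zx].
have yc : y \in c by apply: mem_s; rewrite !inE eqxx orbT.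
have zc : z \in c by apply: mem_s; rewrite !inE mem_rcons mem_head !orbT.
have [_ py] := parent_relP xy (max_x _ yc).
have xz : parent_rel x z by rewrite parent_rel_sym.
have [_ pz] := parent_relP xz (max_x _ zc).
by move: uniq_s; rewrite -py pz mem_rcons mem_head /= andbF.
Qed.

Lemma parent_rel_tree : is_tree parent_rel.
Proof.
split; [split | |].
- exact: parent_rel_sym.
- exact: parent_rel_irr.
- exact: parent_rel_connected.
- exact: parent_rel_acyclic.
Qed.

Lemma parent_rel_leaf x :
  x != r -> (forall y, y != r -> p y != x) -> x \in leaves parent_rel.
Proof.
move=> nr no_child; rewrite inE /degree.
suff -> : [set y | parent_rel x y] = [set p x] by rewrite cards1.
apply/setP=> y; rewrite !inE /parent_rel /= nr /= eq_sym.
by case: (eqVneq y r) => [_ | /no_child/negPf->] /=; rewrite ?andbF orbF.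
Qed.

End ParentTree.

(** A breadth-first search: the depth of [x] is the index of the first layer
    that contains it. *)
Lemma bfs_parent (T : finType) (g : rel T) (r : T) :
  (forall x, connect g r x) ->
  exists p : T -> T, exists d : T -> nat,
    forall x, x != r -> g (p x) x /\ d (p x) < d x.
Proof.
move=> reach_r.
pose next (A : {set T}) := A :|: [set y | [exists z in A, g z y]].
pose layer n := iter n next [set r].
have in_layer x : exists n, x \in layer n.
  have /connectP[s] := reach_r x.
  elim/last_ind: s x => [x _ -> | s y IHs x]; first by exists 0; rewrite inE.
  rewrite rcons_path last_rcons => /andP[path_s sy] ->.
  have [n last_n] := IHs _ path_s erefl; exists n.+1.
  rewrite inE; apply/orP; right; rewrite inE; apply/existsP.
  by exists (last r s); rewrite last_n.
pose d x := ex_minn (in_layer x).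
have d_le x n : x \in layer n -> d x <= n.
  by move=> xn; rewrite /d; case: ex_minnP => m _; apply.
have up x : x != r -> exists z, g z x && (d z < d x).
  rewrite {2}/d; case: ex_minnP => [[|n]]; first by rewrite inE => ->.
  rewrite inE => /orP[xn /(_ _ xn) | ]; first by rewrite ltnn.
  rewrite inE => /existsP[z /andP[zn gzx]] _ _.
  by exists z; rewrite gzx ltnS d_le.
exists (fun x => odflt r [pick z | g z x && (d z < d x)]), d => x /up[z0 z0P].
by case: pickP => [z /andP[]// | /(_ z0)]; rewrite z0P.
Qed.

Lemma disjoint_setU1 (T : finType) (x : T) (A B : {set T}) :
  [disjoint x |: A & B] = (x \notin B) && [disjoint A & B].
Proof. by rewrite !disjoints_subset subUset sub1set inE. Qed.


(** * Connected dominating sets *)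

Section Graph.
Variables (T : finType) (e : rel T).
Hypotheses (sym_e : symmetric e) (irr_e : irreflexive e).
Implicit Types (I J : {set T}) (r u v w x y z : T).

Definition nbrs x : {set T} := [set y | e x y].

(** The lock keeps [inE] from unfolding membership in [ball I]. *)
Definition ball I : {set T} := locked (I :|: \bigcup_(x in I) nbrs x).

Lemma ballE I : ball I = I :|: \bigcup_(x in I) nbrs x.
Proof. by rewrite /ball -lock. Qed.

(** [I] is connected and contains [r].  Only the source of an edge is
    required to lie in [I], so that paths may end in [ball I] outside [I]. *)
Definition rooted r I : Prop :=
  r \in I /\ {in ball I, forall x, connect [rel x y | (x \in I) && e x y] r x}.

Lemma degreeE x : degree e x = #|nbrs x|.
Proof. by []. Qed.

Lemma sub_ball I : I \subset ball I.
Proof. by rewrite ballE subsetUl. Qed.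

Lemma nbrs_sub_ball I x : x \in I -> nbrs x \subset ball I.
Proof.
by move=> xI; rewrite ballE; apply: subsetU; rewrite (bigcup_sup x xI) ?orbT.
Qed.

Lemma ballU1 I v : v \in ball I -> ball (v |: I) = ball I :|: nbrs v.
Proof.
move=> vB; rewrite [LHS]ballE bigcup_setU big_set1 -setUA.
rewrite [nbrs v :|: _]setUC 2!setUA -(setUA [set v]) -ballE.
by congr (_ :|: _); apply/setUidPr; rewrite sub1set.
Qed.

Lemma ball1 r : ball [set r] = r |: nbrs r.
Proof. by rewrite ballE big_set1. Qed.

(** In a breadth-first tree that uses only the edges leaving [I], every parent
    lies in [I]. *)
Lemma rooted_spanning_tree r I :
  rooted r I -> ball I = setT ->
  exists t, spanning_tree e t /\ ~: I \subset leaves t.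
Proof.
move=> [rI reach] dom_I.
have [|p [d pdP]] := @bfs_parent _ [rel x y | (x \in I) && e x y] r.
  by move=> x; apply: reach; rewrite dom_I inE.
have depth_p x : x != r -> d (p x) < d x by case/pdP.
exists (parent_rel r p); split; first split.
- move=> x y /orP[] /andP[/pdP[/andP[_ pe] _] /eqP <-] //.
  by rewrite sym_e.
- exact: parent_rel_tree depth_p.
apply/subsetP=> x; rewrite inE => xI.
apply: parent_rel_leaf => [| y /pdP[/andP[pyI _] _]].
  by apply: contraNneq xI => ->.
by apply: contraNneq xI => <-.
Qed.

Lemma rooted1 r : rooted r [set r].
Proof.
split=> [|x]; first exact: set11.
rewrite ball1 !inE => /orP[/eqP-> | erx]; first exact: connect0.
by apply: connect1; rewrite /= set11.
Qed.

Lemma rootedU1 r I v : rooted r I -> v \in ball I -> rooted r (v |: I).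
Proof.
move=> [rI reach] vB; split; first by rewrite inE rI orbT.
have reach' x : x \in ball I ->
    connect [rel x y | (x \in v |: I) && e x y] r x.
  move/reach; apply: connect_sub => y z /= /andP[yI eyz].
  by apply: connect1; rewrite /= inE yI orbT.
move=> x; rewrite (ballU1 vB) inE => /orP[/reach' // | ].
rewrite inE => evx; apply: connect_trans (reach' _ vB) _.
by apply: connect1; rewrite /= setU11.
Qed.

(** * Growing a connected set *)

Definition pendant : bool := [exists x, degree e x == 1].

Definition dead I : {set T} := [set y in ball I :\: I | nbrs y \subset ball I].

(** The final boolean is the unit that the last step must provide when there
    is no pendant vertex. *)
Definition dense I : bool :=
  3 * #|I| + 5 + (pendant || (ball I == setT)) <= 2 * #|ball I| + #|dead I|.

Lemma in_dead I y :
  (y \in dead I) = [&& y \notin I, y \in ball I & nbrs y \subset ball I].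
Proof. by rewrite !inE andbA. Qed.

Lemma dead_sub I J :
  ball I \subset ball J -> [disjoint J & dead I] -> dead I \subset dead J.
Proof.
move=> sub_B dis; apply/subsetP=> y yD; rewrite in_dead.
rewrite (disjointFl dis yD).
move: yD; rewrite in_dead => /and3P[_ yB nB].
by rewrite (subsetP sub_B) // (subset_trans nB sub_B).
Qed.

Lemma dead_full J : ball J = setT -> dead J = ~: J.
Proof.
move=> full; apply/setP=> y; rewrite in_dead full subsetT.
by rewrite !inE !andbT.
Qed.

Lemma disjoint_dead I : [disjoint I & dead I].
Proof.
by rewrite -setI_eq0; apply/eqP/setP=> y; rewrite !inE; case: (y \in I).
Qed.

Lemma live_notin_dead I v x : e v x -> x \notin ball I -> v \notin dead I.
Proof.
move=> evx; apply: contra; rewrite in_dead => /and3P[_ _ /subsetP]; apply.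
by rewrite inE.
Qed.

Lemma outside_notin_dead I x : x \notin ball I -> x \notin dead I.
Proof. by apply: contra; rewrite in_dead => /and3P[]. Qed.

Lemma live_notin I v x : e v x -> x \notin ball I -> v \notin I.
Proof.
move=> evx; apply: contra => vI; apply: (subsetP (nbrs_sub_ball vI)).
by rewrite inE.
Qed.

Lemma card_ballU1 I v :
  v \in ball I -> #|ball (v |: I)| = #|ball I| + #|nbrs v :\: ball I|.
Proof.
move=> vB; rewrite (ballU1 vB) cardsU setIC.
by have := cardsID (ball I) (nbrs v); lia.
Qed.

Lemma card_dead_add I J (X : {set T}) :
  dead I \subset dead J -> X \subset dead J -> [disjoint X & dead I] ->
  #|dead I| + #|X| <= #|dead J|.
Proof.
move=> sub_I sub_X dis; rewrite addnC -cardsUI.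
rewrite (disjoint_setI0 dis) cards0 addn0 subset_leq_card //.
by rewrite subUset sub_X sub_I.
Qed.

(** Once every vertex is reached, even new leaves are dead: this is where the
    extra unit of the last step comes from. *)
Lemma card_dead_full I J (X : {set T}) :
  dead I \subset dead J -> ball J = setT ->
  [disjoint X & ball I] -> [disjoint X & J] ->
  #|dead I| + #|X| <= #|dead J|.
Proof.
move=> sub_D full dis_B dis_J; apply: card_dead_add => //.
  by rewrite dead_full // -disjoints_subset.
apply: disjointWr dis_B; apply/subsetP=> y.
by rewrite in_dead => /and3P[].
Qed.

Lemma boundary_edge I :
  connected_graph e -> I != set0 -> I != setT ->
  exists v x, [/\ v \in I, x \notin I & e v x].
Proof.
move=> conn /set0Pn[a aI] not_full.
have [z zI] : exists z, z \notin I.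
  apply/existsP; apply: contraR not_full; rewrite negb_exists => /forallP all_I.
  by apply/eqP/setP=> z; rewrite inE; have := all_I z; rewrite negbK.
have /connectP[s path_s def_z] := conn a z.
elim: s a aI path_s def_z => [|b s IHs] a aI /=
  => [_ def_z | /andP[eab path_s] def_z].
  by rewrite def_z aI in zI.
case: (boolP (b \in I)) => [bI | bI]; first exact: (IHs b).
by exists a, b.
Qed.

(** Promoting one leaf, or a leaf and its outer neighbour, costs [3] for each
    promoted vertex; the cases differ in how new vertices and dead leaves
    pay for it. *)
Lemma dense_step r I :
  connected_graph e -> (forall x, degree e x <> 2) ->
  rooted r I -> dense I -> ball I != setT ->
  exists J, [/\ rooted r J, dense J & I \proper J].
Proof.
move=> conn no2 rooted_I dense_I not_full.
have [|v [x [vB xB evx]]] := boundary_edge conn _ not_full.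
  by apply/set0Pn; exists r; apply: (subsetP (sub_ball I)); case: rooted_I.
move: dense_I; rewrite /dense (negPf not_full) orbF => dense_I.
have promote w z : w \in ball I -> e w z -> z \notin ball I ->
    [/\ rooted r (w |: I), #|w |: I| = #|I|.+1,
        I \proper w |: I & dead I \subset dead (w |: I)].
  move=> wB ewz zB; have wI := live_notin ewz zB; split.
  - exact: rootedU1.
  - by rewrite cardsU1 wI.
  - by rewrite properUr // sub1set.
  - apply: dead_sub; first by rewrite ballU1 ?subsetUl.
    by rewrite disjoint_setU1 disjoint_dead (live_notin_dead ewz zB).
(* At least two new vertices: [2 * 2 > 3], with the surplus to spare. *)
have [w /andP[wB out2] | no_out2] :=
    pickP [pred w | (w \in ball I) && (1 < #|nbrs w :\: ball I|)].
  have /card_gt0P[z] : 0 < #|nbrs w :\: ball I| by apply: ltnW.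
  rewrite !inE => /andP[zB ewz].
  have [rooted_J card_J IJ dead_J] := promote w z wB ewz zB.
  exists (w |: I); split=> //; rewrite /dense card_J card_ballU1 //.
  have := subset_leq_card dead_J; move: out2 dense_I; rewrite /=.
  by clear; case: pendant; case: (_ == _) => /=; lia.
have out1 w z : w \in ball I -> e w z -> z \notin ball I ->
    nbrs w :\: ball I = [set z].
  move=> wB ewz zB; apply/esym/eqP; rewrite eqEcard cards1 sub1set !inE zB ewz.
  by have /negbT := no_out2 w; rewrite /= wB -leqNgt.
have [rooted_v card_v I_v dead_v] := promote v x vB evx xB.
have ball_v w z : w \in ball I -> e w z -> z \notin ball I ->
    ball (w |: I) = z |: ball I.
  move=> wB ewz zB.
  rewrite ballU1 // -(out1 w z) //; apply/setP=> y; rewrite !inE.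
  by case: (y \in ball I); rewrite /= ?orbT ?orbF.
have ball_vx := ball_v v x vB evx xB.
have card_ball_v : #|ball (v |: I)| = #|ball I|.+1.
  by rewrite ball_vx cardsU1 xB.
have xI : x \notin I by apply: contra xB; apply: (subsetP (sub_ball I)).
have xv : x != v by apply: contraNneq xB => ->.
have x_leaf : x \notin v |: I by rewrite !inE negb_or xv.
have x_notdead := outside_notin_dead xB.
(* One new vertex, which is a dead leaf: [2 + 1 = 3]. *)
have [deg_x | deg_x] := eqVneq (degree e x) 1.
  have pend : pendant by apply/existsP; exists x; rewrite deg_x.
  have dead1 : #|dead I| + #|[set x]| <= #|dead (v |: I)|.
    apply: card_dead_add; rewrite ?disjoints1 // sub1set in_dead x_leaf.
    have /eqP/cards1P[y def_x] := deg_x.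
    have : v \in [set y] by rewrite -def_x inE sym_e.
    rewrite /nbrs def_x ball_vx setU11 inE => /eqP <-.
    by rewrite sub1set !inE vB orbT.
  exists (v |: I); split=> //; rewrite /dense card_v card_ball_v.
  by move: dead1 dense_I; rewrite pend cards1 /=; clear; lia.
(* One new vertex [x], the only outer neighbour of another leaf [y], which
   dies: [2 + 1 = 3].  If [x] was the last vertex, it is dead as well. *)
have [y /and3P[yB yv exy] | no_y] :=
    pickP [pred y | [&& y \in ball I, y != v & e x y]].
  have eyx : e y x by rewrite sym_e.
  have yI := live_notin eyx xB.
  have y_notdead := live_notin_dead eyx xB.
  have y_dead : y \in dead (v |: I).
    rewrite in_dead !inE negb_or yv yI /= ball_vx -(ball_v y x) //.
    by rewrite nbrs_sub_ball ?setU11 // (subsetP (sub_ball _)) ?setU11.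
  exists (v |: I); split=> //; rewrite /dense card_v card_ball_v.
  have dead1 : #|dead I| + #|[set y]| <= #|dead (v |: I)|.
    by apply: card_dead_add; rewrite ?disjoints1 ?sub1set.
  have [full | _] := eqVneq (ball (v |: I)) setT; last first.
    by move: dead1 dense_I; rewrite cards1 orbF; clear; lia.
  have dead2 : #|dead I| + #|[set x; y]| <= #|dead (v |: I)|.
    apply: card_dead_add => //.
      by rewrite subUset !sub1set y_dead dead_full // inE x_leaf.
    by rewrite disjoint_setU1 x_notdead disjoints1.
  have xy : x != y by apply: contraNneq xB => ->.
  move: dead2 dense_I; rewrite cards2 xy orbT; clear.
  by case: pendant => /=; lia.
(* Both [v] and [x] are promoted: [x] and two further vertices are new, and
   [2 * 3 = 3 + 3].  If they were the last ones, the two are dead leaves. *)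
have x_in : x \in ball (v |: I) by rewrite ball_vx setU11.
have out_x : nbrs x :\: ball (v |: I) = nbrs x :\ v.
  apply/setP=> y; rewrite ball_vx !inE negb_or.
  have := no_y y; rewrite /=; case: (eqVneq y v) => [-> | _].
    by rewrite vB /= andbF.
  case: (eqVneq y x) => [-> | _]; first by rewrite irr_e.
  by case: (y \in ball I) => //= ->.
have card_out : 1 < #|nbrs x :\: ball (v |: I)|.
  have := cardsD1 v (nbrs x); rewrite -out_x -degreeE inE sym_e evx.
  by move: deg_x (no2 x); clear; lia.
have x_live z : z \in nbrs x :\: ball (v |: I) -> e x z /\ z \notin ball I.
  by rewrite ball_vx !inE negb_or => /andP[/andP[]].
have dead_x : dead I \subset dead (x |: (v |: I)).
  apply: dead_sub.
    by rewrite ballU1 // ball_vx -setUA subsetU // subsetUl orbT.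
  by rewrite !disjoint_setU1 x_notdead (live_notin_dead evx xB) disjoint_dead.
exists (x |: (v |: I)); split.
- exact: rootedU1.
- rewrite /dense card_ballU1 // card_ball_v cardsU1 x_leaf card_v.
  have [full | _] := eqVneq (ball (x |: (v |: I))) setT; last first.
    have := subset_leq_card dead_x; move: card_out dense_I; rewrite orbF.
    by clear; lia.
  have : #|dead I| + #|nbrs x :\: ball (v |: I)| <= #|dead (x |: (v |: I))|.
    apply: card_dead_full => //; rewrite disjoints_subset;
      apply/subsetP=> z /x_live[exz zB]; rewrite inE //.
    rewrite !inE; apply/negP=> /or3P[/eqP z_x | /eqP z_v | zI].
    + by rewrite z_x irr_e in exz.
    + by rewrite z_v vB in zB.
    + by rewrite (subsetP (sub_ball I)) in zB.
  by move: card_out dense_I; case: pendant; rewrite /= ?orbT; clear; lia.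
- by apply: proper_trans I_v _; rewrite properUr // sub1set.
Qed.

Lemma dense_full r I :
  connected_graph e -> (forall x, degree e x <> 2) ->
  rooted r I -> dense I ->
  exists J, [/\ rooted r J, dense J & ball J = setT].
Proof.
move=> conn no2; have [n] := ubnP #|~: I|; elim: n I => // n IHn I lt_n rI dI.
have [full | not_full] := eqVneq (ball I) setT; first by exists I.
have [J [rJ dJ IJ]] := dense_step conn no2 rI dI not_full.
rewrite ltnS in lt_n; apply: (IHn J) => //; apply: leq_trans lt_n.
by apply: proper_card; rewrite properC.
Qed.

(** * The starting star and the final count *)

Lemma dense_star r :
  2 < degree e r -> (pendant -> exists2 u, e r u & degree e u = 1) ->
  dense [set r].
Proof.
rewrite degreeE /dense ball1 => deg_r near_pendant.
have card_star : #|r |: nbrs r| = #|nbrs r|.+1.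
  by rewrite cardsU1 inE irr_e.
rewrite card_star cards1.
suff : (pendant || (r |: nbrs r == setT)) <= #|dead [set r]|.
  by move: deg_r; clear; lia.
have [/near_pendant[u eru /eqP/cards1P[w nbrs_u]] | _ /=] := boolP pendant.
  apply/card_gt0P; exists u.
  rewrite in_dead ball1 /nbrs nbrs_u sub1set !inE eru.
  have : r \in [set w] by rewrite -nbrs_u inE sym_e.
  rewrite inE => /eqP <-; rewrite eqxx orbT !andbT.
  by apply: contraTneq eru => ->; rewrite irr_e.
case: eqP => // full; rewrite dead_full ?ball1 //.
have /card_gt0P[u] : 0 < #|nbrs r| by move: deg_r; clear; lia.
rewrite inE => eru; apply/card_gt0P; exists u; rewrite !inE.
by apply: contraTneq eru => ->; rewrite irr_e.
Qed.

Lemma degree_gt0 x : connected_graph e -> 1 < #|T| -> 0 < degree e x.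
Proof.
move=> conn card_T.
have [||v [y [/set1P-> _ exy]]] := boundary_edge (I := [set x]) conn.
- by apply/set0Pn; exists x; apply: set11.
- by apply: contraTneq card_T => full; rewrite -cardsT -full cards1.
by apply/card_gt0P; exists y; rewrite inE.
Qed.

Lemma dense_start :
  connected_graph e -> (forall x, degree e x <> 2) -> 2 < #|T| ->
  exists r, dense [set r].
Proof.
move=> conn no2 card_T; have deg_gt0 x := degree_gt0 x conn (ltnW card_T).
have deg_gt2 x : degree e x <> 1 -> 2 < degree e x.
  by move: (deg_gt0 x) (no2 x); clear; lia.
have [pend | no_pend] := boolP pendant; last first.
  have /card_gt0P[r _] : 0 < #|T| by apply: leq_trans card_T.
  exists r; apply: dense_star; last by rewrite (negPf no_pend).
  apply: deg_gt2 => deg_r; case/negP: no_pend.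
  by apply/existsP; exists r; rewrite deg_r.
have /existsP[u /eqP deg_u] := pend.
have /eqP/cards1P[w nbrs_u] := deg_u.
have euw : e u w by have := set11 w; rewrite -nbrs_u inE.
exists w; apply: dense_star => [|_]; last by exists u; rewrite // sym_e.
(* Two adjacent pendant vertices would form a whole component. *)
apply: deg_gt2 => /eqP/cards1P[u' nbrs_w].
have def_u' : u' = u by apply/esym/set1P; rewrite -nbrs_w inE sym_e.
have [||v [x [v_uw x_uw evx]]] := boundary_edge (I := [set u; w]) conn.
- by apply/set0Pn; exists u; apply: set21.
- apply: contraTneq card_T => full; rewrite -cardsT -full cards2.
  by case: (u != w).
move: x_uw; rewrite !inE negb_or => /andP[xu xw].
have : x \in [set y | e v y] by rewrite inE.
case/set2P: v_uw => ->; rewrite ?nbrs_u ?nbrs_w ?def_u' inE.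
- by rewrite (negPf xw).
- by rewrite (negPf xu).
Qed.

Lemma spanning_tree_many_leaves :
  connected_graph e -> (forall x, degree e x <> 2) -> 2 < #|T| ->
  exists t, spanning_tree e t /\ #|T| + 6 <= 4 * #|leaves t|.
Proof.
move=> conn no2 card_T; have [r dense_r] := dense_start conn no2 card_T.
have [J [rooted_J dense_J full]] := dense_full conn no2 (rooted1 r) dense_r.
have [t [span_t /subset_leq_card le_leaves]] :=
  rooted_spanning_tree rooted_J full.
exists t; split=> //; move: dense_J le_leaves (cardsC J).
by rewrite /dense full eqxx orbT (dead_full full) cardsT; clear; lia.
Qed.

(** The single edge: no vertex has degree at least [3], so there is no star
    to start from. *)
Lemma tree_order2 :
  connected_graph e -> #|T| = 2 -> spanning_tree e e /\ leaves e = setT.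
Proof.
move=> conn card_T; split; first split=> //.
  split=> // c size_c /andP[_ /card_uniqP card_c].
  by have := max_card (mem c); rewrite card_c card_T leqNgt size_c.
apply/setP=> x; rewrite !inE eqn_leq degree_gt0 ?card_T // andbT.
have : nbrs x \subset [set~ x].
  by apply/subsetP=> y; rewrite !inE; apply: contraTneq => ->; rewrite irr_e.
by move/subset_leq_card; rewrite cardsC1 card_T.
Qed.

End Graph.

Import GRing.Theory Num.Theory.
Local Open Scope ring_scope.

Theorem corollary1 (T : finType) (e : rel T)
    (simple_e : simple_graph e)
    (conn_e : connected_graph e)
    (card_T : (2 <= #|T|)%N)
    (no_deg2 : forall x : T, degree e x <> 2%N) :
  exists t : rel T,
    spanning_tree e t /\
    (1 / 4) * (#|T|%:R - 2) + 2 <= #|leaves t|%:R :> rat.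
Proof.
have [sym_e irr_e] := simple_e.
suff [t [span_t]] :
    exists t, spanning_tree e t /\ (#|T| + 6 <= 4 * #|leaves t|)%N.
  by rewrite -(ler_nat rat) natrD natrM => le_t; exists t; split=> //; lra.
move: card_T; rewrite leq_eqVlt => /orP[/eqP card_T | card_T].
  have [span_e leaves_e] := tree_order2 sym_e irr_e conn_e (esym card_T).
  by exists e; rewrite leaves_e cardsT -card_T.
exact: spanning_tree_many_leaves.
Qed.
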